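(* For each $A \subseteq X$ define $S_{A} = \{ \alpha \in \mathbb{3}^{X} : Ann(\alpha) = I_{A} \}$, where $I_{A} = \{ \alpha \in \mathbb{3}^{X} : \alpha(y) = U \text{ for all } y \in A \}$. The collection $\{ S_{A} : A \subseteq X \}$ forms a partition of $\mathbb{3}^{X}$ in which all the elements of $\mathbb{2}^{X}$ (the $\{T,F\}$-valued functions) form a single equivalence class, namely $S_X = \mathbb{2}^X$.
   Context: $\mathbb{3} = \{T, F, U\}$ is McCarthy's three-valued logic: $\neg T = F$, $\neg F = T$, $\neg U = U$; $T \wedge y = y$, $F \wedge y = F$, $U \wedge y = U$; $T \vee y = T$, $F \vee y = y$, $U \vee y = U$. For a set $X$, $\mathbb{3}^{X}$ carries the pointwise operations, with constant ${\bf U}$ identically $U$. For $a \in \mathbb{3}^X$, $Ann(a) = \{ \alpha \in \mathbb{3}^X : (\alpha \wedge a) \vee (\neg \alpha \wedge a) = {\bf U} \}$. *)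

(* Defs.v *)
From mathcomp Require Import all_boot.
From mathcomp Require Import boolp classical_sets.
Set Implicit Arguments.
Unset Strict Implicit.
Unset Printing Implicit Defensive.

Local Open Scope classical_set_scope.

Inductive three : Type := T3 | F3 | U3.

Definition neg3 (x : three) : three :=
  match x with T3 => F3 | F3 => T3 | U3 => U3 end.

(* McCarthy's connectives are evaluated from left to right, so they are not
   commutative. *)
Definition and3 (x y : three) : three :=
  match x with T3 => y | F3 => F3 | U3 => U3 end.

Definition or3 (x y : three) : three :=
  match x with T3 => T3 | F3 => y | U3 => U3 end.

Section ThreeX.
Variable X : Type.
Implicit Types (a b : X -> three) (A : set X).

Definition f_neg a : X -> three := fun x => neg3 (a x).
Definition f_and a b : X -> three := fun x => and3 (a x) (b x).
Definition f_or a b : X -> three := fun x => or3 (a x) (b x).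
Definition f_U : X -> three := fun=> U3.

Definition Ann a : set (X -> three) :=
  [set alpha | f_or (f_and alpha a) (f_and (f_neg alpha) a) = f_U].

Definition I_ A : set (X -> three) :=
  [set alpha | forall y, A y -> alpha y = U3].

Definition S_ A : set (X -> three) := [set alpha | Ann alpha = I_ A].

(* 2^X, viewed as a subset of 3^X *)
Definition twoX : set (X -> three) :=
  [set alpha | forall x, alpha x = T3 \/ alpha x = F3].

End ThreeX.

Arguments twoX : clear implicits.

(* Main.v *)
Require Import Defs.
From mathcomp Require Import all_boot.
From mathcomp Require Import boolp classical_sets.
Local Open Scope classical_set_scope.

(** Computing pointwise, [alpha] annihilates [a] iff [alpha] is [U3] wherever [a]
    is not, so [Ann a] is [I_] of the set where [a] is defined. As [A] can be
    recovered from [I_ A], the class [S_ A] consists of the functions that are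
    defined exactly on [A]. *)

Definition defined_on {X : Type} (a : X -> three) : set X :=
  [set x | a x <> U3].

(** At each point the defining expression evaluates to [a x] when [alpha x] is [T3] or [F3], and to
    [U3] when [alpha x] is [U3]. *)
Lemma Ann_defined_on (X : Type) (a : X -> three) : Ann a = I_ (defined_on a).
Proof.
apply/seteqP; split=> alpha.
  move=> alphaP x; rewrite /defined_on /=.
  have := congr1 (@^~ x) alphaP.
  by rewrite /f_or /f_and /f_neg /f_U; case: (alpha x); case: (a x).
move=> alphaP; apply/funext => x.
move: (alphaP x); rewrite /defined_on /f_or /f_and /f_neg /f_U /=.
by case: (alpha x); case: (a x) => // /(_ _)/wrap[].
Qed.

Definition indicator3 {X : Type} (A : set X) (x : X) : three :=
  if `[< A x >] then T3 else U3.

Lemma defined_on_indicator3 (X : Type) (A : set X) :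
  defined_on (indicator3 A) = A.
Proof.
by apply/seteqP; split=> x; rewrite /defined_on /indicator3 /=; case: asboolP.
Qed.

Lemma I_subset (X : Type) (A B : set X) : I_ A `<=` I_ B -> B `<=` A.
Proof.
move=> IAB x Bx; apply: contrapT => nAx.
have /IAB/(_ x Bx) : I_ A (indicator3 (~` A)).
  by move=> y Ay; rewrite /indicator3 asboolF //; apply.
by rewrite /indicator3 asboolT.
Qed.

Lemma I_inj (X : Type) (A B : set X) : I_ A = I_ B -> A = B.
Proof. by move=> IAB; apply/seteqP; split; apply: I_subset; rewrite IAB. Qed.

Lemma S_E (X : Type) (A : set X) : S_ A = [set alpha | defined_on alpha = A].
Proof.
apply/seteqP; split=> alpha; rewrite /S_ /= Ann_defined_on; first exact: I_inj.
by move=> ->.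
Qed.

Lemma S_setT (X : Type) : S_ [set: X] = twoX X.
Proof.
rewrite S_E; apply/seteqP; split=> alpha /=.
  move=> def_alpha x; have : defined_on alpha x by rewrite def_alpha.
  by rewrite /defined_on /=; case: (alpha x) => // _; [left | right].
move=> two_alpha; apply/seteqP; split=> // x _.
by rewrite /defined_on /=; case: (two_alpha x) => ->.
Qed.

Theorem theorem4p15 (X : Type) :
  partition (range (@S_ X)) id [set: X -> three] /\
  (range (@S_ X) (twoX X) /\ S_ [set: X] = twoX X).
Proof.
split; last by split; [exists [set: X]; rewrite ?S_setT | exact: S_setT].
split.
- apply/seteqP; split=> // alpha _.
  exists (S_ (defined_on alpha)); first by exists (defined_on alpha).
  by rewrite S_E.
(* A function common to two classes has a single domain of definition, which is both [A] and [B]. *)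
- move=> _ _ [A _ <-] [B _ <-] [alpha []].
  by rewrite !S_E /= => -> ->.
(* Blocks of a partition must be nonempty. *)
- move=> _ [A _ <-]; exists (indicator3 A).
  by rewrite S_E /= defined_on_indicator3.
Qed.
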